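(* Let $A,P\in\mathbb{R}^{n\times n}$ be invertible, $b\in\mathbb{R}^n$, and consider NGMRESr($m$) used to accelerate the preconditioned Richardson iteration $q(x)=x+P(b-Ax)$ for solving $Ax=b$. Let $B=I-PA$ and $r_{k}=P(Ax_{k}-b)$. Then for every $k\ge0$ the least-squares problem defining $\boldsymbol{\beta}^{(k)}$ can be rewritten as $$\min_{\boldsymbol{\beta}^{(k)}}\|r_{k+1}\|^2=\min_{\boldsymbol{\beta}^{(k)}}\|Br_k-E_k\boldsymbol{\beta}^{(k)}\|^2,$$ i.e. for every coefficient vector $\boldsymbol{\beta}^{(k)}$ its objective equals $\|r_{k+1}\|^2$ (with $x_{k+1}$, hence $r_{k+1}$, regarded as a function of $\boldsymbol{\beta}^{(k)}$) and equals $\|Br_k-E_k\boldsymbol{\beta}^{(k)}\|^2$, where $$E_k=[\,r_k-Br_k,\ r_{k-1}-Br_k,\ \dots,\ r_{k-m_k}-Br_k\,].$$ Moreover, for the iterates generated by NGMRESr($m$) and all $i,j=0,1,\dots,m_k$, $$r_{k+1}^T(PA)r_k=0,\qquad r_{k+1}^T(r_{k-j}-r_{k-i})=0,$$ and $$\|r_{k+1}\|\le\|r_k\|.$$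
   Context: $\|\cdot\|$ is the Euclidean 2-norm, and $r(x)=x-q(x)=P(Ax-b)$ is the preconditioned residual. NGMRESr($m$), $m\ge0$ an integer: given $x_0\in\mathbb{R}^n$, for $k=0,1,2,\dots$ let $m_k=\min\{k,m\}$ and set $$x_{k+1}=q(x_k)+\sum_{i=0}^{m_k}\beta_i^{(k)}\big(q(x_k)-x_{k-i}\big),$$ where $\boldsymbol{\beta}^{(k)}=(\beta_0^{(k)},\dots,\beta_{m_k}^{(k)})\in\mathbb{R}^{m_k+1}$ is obtained by solving the least-squares problem $$\min_{\boldsymbol{\beta}^{(k)}}\Big\|r(q(x_k))+\sum_{i=0}^{m_k}\beta_i^{(k)}\big(r(q(x_k))-r(x_{k-i})\big)\Big\|^2 .$$ *)

(* Defs.v *)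
From mathcomp Require Import all_boot all_order all_algebra reals.

Set Implicit Arguments.
Unset Strict Implicit.
Unset Printing Implicit Defensive.

Import Order.TTheory GRing.Theory Num.Theory.
Local Open Scope ring_scope.

Definition enorm (R : realType) (n : nat) (v : 'cV[R]_n) : R :=
  Num.sqrt (\sum_(s < n) v s 0 ^+ 2).

Definition richardson (R : realType) (n : nat) (A P : 'M[R]_n) (b : 'cV[R]_n)
  (x : 'cV[R]_n) : 'cV[R]_n := x + P *m (b - A *m x).

Definition precond_residual (R : realType) (n : nat) (A P : 'M[R]_n)
  (b : 'cV[R]_n) (x : 'cV[R]_n) : 'cV[R]_n := P *m (A *m x - b).

(* NGMRESr(m) for a fixed-point map q, with residual r(x) = x - q(x).
   The coefficient vector at step k has m_k + 1 entries, m_k = min(k, m); for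
   i <= m_k the natural-number subtraction k - i is never truncated. *)

Definition fp_residual (R : realType) (n : nat) (q : 'cV[R]_n -> 'cV[R]_n)
  (x : 'cV[R]_n) : 'cV[R]_n := x - q x.

Definition ngmresr_step (R : realType) (n : nat) (q : 'cV[R]_n -> 'cV[R]_n)
    (m : nat) (x : nat -> 'cV[R]_n) (k : nat) (beta : 'cV[R]_(minn k m).+1) :
    'cV[R]_n :=
  q (x k) + \sum_(i < (minn k m).+1) beta i 0 *: (q (x k) - x (k - i)%N).

Definition ngmresr_objective (R : realType) (n : nat)
    (q : 'cV[R]_n -> 'cV[R]_n) (m : nat) (x : nat -> 'cV[R]_n) (k : nat)
    (beta : 'cV[R]_(minn k m).+1) : R :=
  let r := fp_residual q in
  enorm (r (q (x k)) +
         \sum_(i < (minn k m).+1)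
            beta i 0 *: (r (q (x k)) - r (x (k - i)%N))) ^+ 2.

(* The minimizer need not be unique: any choice of minimizers is allowed. *)
Definition ngmresr (R : realType) (n : nat) (q : 'cV[R]_n -> 'cV[R]_n)
    (m : nat) (x : nat -> 'cV[R]_n)
    (beta : forall k : nat, 'cV[R]_(minn k m).+1) : Prop :=
  forall k : nat,
    (forall gamma : 'cV[R]_(minn k m).+1,
       ngmresr_objective q x (beta k) <= ngmresr_objective q x gamma) /\
    x k.+1 = ngmresr_step q x (beta k).

Definition ngmresr_mx (R : realType) (n : nat) (B : 'M[R]_n) (m : nat)
    (r : nat -> 'cV[R]_n) (k : nat) : 'M[R]_(n, (minn k m).+1) :=
  \matrix_(s, j) (r (k - j)%N - B *m r k) s 0.

(* Main.v *)
Require Import Defs.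
From mathcomp Require Import all_boot all_order all_algebra reals.
From mathcomp Require Import ring lra.

Import Order.TTheory GRing.Theory Num.Theory.
Local Open Scope ring_scope.

(** The fixed-point residual of the Richardson map is the preconditioned
    residual [P (A x - b)], an affine function of [x] with linear part [P A].
    An NGMRESr step is [q x_k] plus multiples of differences of points, and an
    affine map sends such an expression to the same expression in the images;
    hence the objective is the squared norm of the new residual
    ([precond_residual_extrapolation]).  Since a Richardson step multiplies the
    residual by [B = 1 - P A] ([precond_residual_richardson]), the new residual
    is [B r_k - E_k beta], so step [k] is an ordinary linear least-squares
    problem in [beta].

    A minimizer of a linear least-squares problem satisfies the normal equations
    ([least_squares_normal]): [r_{k+1}] is orthogonal to every column
    [r_{k-j} - B r_k] of [E_k].  The column [j = 0] is [P A r_k], which gives the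
    first orthogonality relation, and differences of columns are
    [r_{k-j} - r_{k-i}], which gives the second.  Finally, the coefficient vector
    with [-1] in position [0] and zeros elsewhere reproduces [x_k], hence [r_k],
    so the minimum cannot exceed the norm of [r_k]. *)

Lemma enorm_sqrE (R : realType) (n : nat) (v : 'cV[R]_n) :
  enorm v ^+ 2 = (v^T *m v) 0 0.
Proof.
rewrite sqr_sqrtr; last by apply: sumr_ge0 => s _; apply: sqr_ge0.
by rewrite mxE; apply: eq_bigr => s _; rewrite mxE expr2.
Qed.

Lemma enorm_sqr_eq0 (R : realType) (n : nat) (v : 'cV[R]_n) :
  enorm v ^+ 2 = 0 -> v = 0.
Proof.
rewrite sqr_sqrtr; last by apply: sumr_ge0 => s _; apply: sqr_ge0.
move=> /eqP; rewrite psumr_eq0 => [/allP v0|s _]; last exact: sqr_ge0.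
apply/matrixP => s j; rewrite (ord1 j) mxE; apply/eqP.
by move: (v0 s (mem_index_enum s)); rewrite /= sqrf_eq0.
Qed.

Lemma enorm_sqrB (R : realType) (n : nat) (u v : 'cV[R]_n) :
  enorm (u - v) ^+ 2 = enorm u ^+ 2 - (v^T *m u) 0 0 *+ 2 + enorm v ^+ 2.
Proof.
have uvC : (u^T *m v) 0 0 = (v^T *m u) 0 0.
  by rewrite -{2}[u]trmxK -trmx_mul [RHS]mxE.
have entryD (p q : 'M[R]_1) : (p + q) 0 0 = p 0 0 + q 0 0 by rewrite mxE.
have entryN (p : 'M[R]_1) : (- p) 0 0 = - p 0 0 by rewrite mxE.
rewrite !enorm_sqrE [(u - v)^T]linearB /= mulmxBl !mulmxBr.
by rewrite !(entryD, entryN) uvC; ring.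
Qed.

(** Moving from a minimizer along the gradient direction [g = E^T w], with [w]
    the optimal residual, changes the objective by
    [t^2 |E g|^2 - 2 t |g|^2]; this is negative for some small [t > 0] unless
    [g = 0]. *)
Lemma least_squares_normal (R : realType) (n p : nat) (E : 'M[R]_(n, p))
    (v : 'cV[R]_n) (beta : 'cV[R]_p) :
  (forall gamma, enorm (v - E *m beta) ^+ 2 <= enorm (v - E *m gamma) ^+ 2) ->
  E^T *m (v - E *m beta) = 0.
Proof.
move=> min_beta; set w := v - E *m beta; set g := E^T *m w.
apply: enorm_sqr_eq0; apply/eqP/negPn/negP => g_neq0.
set a := enorm g ^+ 2 in g_neq0; set c := enorm (E *m g) ^+ 2.
have a_gt0 : 0 < a by rewrite lt_def g_neq0 sqr_ge0.
have c_ge0 : 0 <= c by apply: sqr_ge0.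
have min_along t : 0 <= t ^+ 2 * c - t * a *+ 2.
  have := min_beta (beta + t *: g).
  rewrite mulmxDr opprD addrA -/w -scalemxAr (enorm_sqrB _ _ w).
  rewrite [X in X *+ 2](_ : _ = t * a); last first.
    rewrite [(t *: _)^T]linearZ /= -scalemxAl mxE; congr (_ * _).
    by rewrite trmx_mul -mulmxA -/g /a enorm_sqrE.
  rewrite [X in _ + X](_ : _ = t ^+ 2 * c); last first.
    rewrite /c !enorm_sqrE [(t *: _)^T]linearZ /= -scalemxAl -scalemxAr.
    by rewrite scalerA mxE.
  lra.
(* The optimal step is a / c; the denominator c + 1 also covers c = 0. *)
have := min_along (a / (c + 1)).
have d_gt0 : 0 < c + 1 by lra.
set t := a / (c + 1); have t_gt0 : 0 < t by apply: divr_gt0.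
have aE : a = t * (c + 1) by rewrite /t divfK // gt_eqF.
rewrite aE; nra.
Qed.

Lemma fp_residual_richardson (R : realType) (n : nat) (A P : 'M[R]_n)
    (b x : 'cV[R]_n) :
  fp_residual (richardson A P b) x = precond_residual A P b x.
Proof.
by rewrite /fp_residual /richardson opprD addNKr -mulmxN opprB.
Qed.

Lemma precond_residualB (R : realType) (n : nat) (A P : 'M[R]_n)
    (b x y : 'cV[R]_n) :
  precond_residual A P b x - precond_residual A P b y = P *m A *m (x - y).
Proof.
by rewrite /precond_residual -mulmxBr opprB addrA subrK -mulmxBr mulmxA.
Qed.

Lemma precond_residual_richardson (R : realType) (n : nat) (A P : 'M[R]_n)
    (b x : 'cV[R]_n) :
  precond_residual A P b (richardson A P b x) =
  (1%:M - P *m A) *m precond_residual A P b x.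
Proof.
have step : richardson A P b x - x = - precond_residual A P b x.
  by rewrite -fp_residual_richardson opprB.
rewrite -[LHS](subrK (precond_residual A P b x)) precond_residualB step.
by rewrite mulmxN mulmxBl mul1mx addrC.
Qed.

(** The weights of [y] and the [z i] sum to one, so the affine residual map
    commutes with the extrapolation. *)
Lemma precond_residual_extrapolation (R : realType) (n p : nat)
    (A P : 'M[R]_n) (b y : 'cV[R]_n) (z : 'I_p -> 'cV[R]_n)
    (gamma : 'I_p -> R) :
  let r := precond_residual A P b in
  r (y + \sum_i gamma i *: (y - z i)) = r y + \sum_i gamma i *: (r y - r (z i)).
Proof.
move=> r; rewrite -[LHS](subrK (r y)) [LHS]addrC precond_residualB.
rewrite [y + _]addrC addrK mulmx_sumr; congr (_ + _); apply: eq_bigr => i _.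
by rewrite precond_residualB scalemxAr.
Qed.

Lemma ngmresr_mx_mul (R : realType) (n : nat) (B : 'M[R]_n) (m : nat)
    (r : nat -> 'cV[R]_n) (k : nat) (gamma : 'cV[R]_(minn k m).+1) :
  ngmresr_mx B m r k *m gamma = \sum_i gamma i 0 *: (r (k - i)%N - B *m r k).
Proof.
apply/colP => s; rewrite mxE summxE; apply: eq_bigr => i _.
by rewrite !mxE mulrC.
Qed.

Lemma col_ngmresr_mx (R : realType) (n : nat) (B : 'M[R]_n) (m : nat)
    (r : nat -> 'cV[R]_n) (k : nat) (j : 'I_(minn k m).+1) :
  col j (ngmresr_mx B m r k) = r (k - j)%N - B *m r k.
Proof. by apply/colP => s; rewrite mxE [LHS]mxE. Qed.

Lemma precond_residual_ngmresr_step (R : realType) (n : nat) (A P : 'M[R]_n)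
    (b : 'cV[R]_n) (m : nat) (x : nat -> 'cV[R]_n) (k : nat)
    (gamma : 'cV[R]_(minn k m).+1) :
  let B := 1%:M - P *m A in
  let r := fun k => precond_residual A P b (x k) in
  precond_residual A P b (ngmresr_step (richardson A P b) x gamma) =
  B *m r k - ngmresr_mx B m r k *m gamma.
Proof.
move=> B r; rewrite precond_residual_extrapolation precond_residual_richardson.
rewrite ngmresr_mx_mul -sumrN; congr (_ + _); apply: eq_bigr => i _.
by rewrite -scalerN opprB.
Qed.

Lemma ngmresr_objective_richardson (R : realType) (n : nat) (A P : 'M[R]_n)
    (b : 'cV[R]_n) (m : nat) (x : nat -> 'cV[R]_n) (k : nat)
    (gamma : 'cV[R]_(minn k m).+1) :
  let q := richardson A P b in
  ngmresr_objective q x gamma =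
  enorm (precond_residual A P b (ngmresr_step q x gamma)) ^+ 2.
Proof.
move=> q; rewrite precond_residual_extrapolation /ngmresr_objective.
rewrite fp_residual_richardson; congr (enorm (_ + _) ^+ 2).
by apply: eq_bigr => i _; rewrite fp_residual_richardson.
Qed.

Theorem theorem3p3 (R : realType) (n : nat) (A P : 'M[R]_n) (b : 'cV[R]_n)
    (m : nat) (x : nat -> 'cV[R]_n)
    (beta : forall k : nat, 'cV[R]_(minn k m).+1)
    (hA : A \in unitmx) (hP : P \in unitmx)
    (hx : ngmresr (richardson A P b) x beta) :
  let q := richardson A P b in
  let B := 1%:M - P *m A in
  let r := fun k : nat => precond_residual A P b (x k) in
  forall k : nat,
    (forall gamma : 'cV[R]_(minn k m).+1,
       ngmresr_objective q x gamma
         = enorm (precond_residual A P b (ngmresr_step q x gamma)) ^+ 2 /\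
       ngmresr_objective q x gamma
         = enorm (B *m r k - ngmresr_mx B m r k *m gamma) ^+ 2) /\
    (r k.+1)^T *m (P *m A) *m r k = 0 /\
    (forall i j : 'I_(minn k m).+1,
       (r k.+1)^T *m (r (k - j)%N - r (k - i)%N) = 0) /\
    enorm (r k.+1) <= enorm (r k).
Proof.
move=> q B r k; set E := ngmresr_mx B m r k.
have objE gamma :
    ngmresr_objective q x gamma = enorm (B *m r k - E *m gamma) ^+ 2.
  by rewrite ngmresr_objective_richardson precond_residual_ngmresr_step.
have [min_beta xS] := hx k.
have rS : r k.+1 = B *m r k - E *m beta k.
  by rewrite {1}/r xS precond_residual_ngmresr_step.
have min_r gamma : enorm (r k.+1) ^+ 2 <= enorm (B *m r k - E *m gamma) ^+ 2.
  by rewrite rS -!objE; apply: min_beta.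
have normal : (r k.+1)^T *m E = 0.
  apply: trmx_inj; rewrite trmx_mul trmxK trmx0 rS.
  by apply: least_squares_normal => gamma; rewrite -rS; apply: min_r.
have orth_col (j : 'I_(minn k m).+1) :
    (r k.+1)^T *m (r (k - j)%N - B *m r k) = 0.
  by rewrite -col_ngmresr_mx colE mulmxA normal mul0mx.
split; first by move=> gamma; split; [exact: ngmresr_objective_richardson|].
split.
  have col0E : r k - B *m r k = P *m A *m r k.
    by rewrite mulmxBl mul1mx opprB addrC subrK.
  by have := orth_col ord0; rewrite subn0 col0E mulmxA.
split.
  move=> i j; rewrite -[_ - _](subrKA (B *m r k)) mulmxDr orth_col add0r.
  by rewrite -opprB mulmxN orth_col oppr0.
have := min_r (- delta_mx ord0 0).
rewrite mulmxN opprK -colE col_ngmresr_mx subn0 addrC subrK.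
by rewrite ler_pXn2r // nnegrE sqrtr_ge0.
Qed.
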